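(* Consider the system $x(t+1)=x(t)-L(t)x(t)$ with $\mathbf{1}^*\mathbb{E}(L(t))=0$. Let $a^{r}_{\max}>0$ and $\alpha>0$ be constants such that almost surely $\sum_{j\ne i}a_{ij}(t)\le a^{r}_{\max}$ and $a_{ii}(t)\ge\alpha$ for all $i\in I$. Suppose that $a_{ij}(t)$ and $a_{kl}(t)$ are uncorrelated whenever $i\ne k$. Then $$\mathbb{E}[L(t)^*\mathbf{1}\mathbf{1}^*L(t)]\le\gamma\,\mathbb{E}[L(t)+L(t)^*-L(t)^*L(t)]\quad\text{with }\gamma=\frac{a^{r}_{\max}}{\alpha},$$ and consequently $\mathbb{E}[(\bar x(t)-\bar x(0))^2]\le\frac{\gamma}{N+\gamma}V(x(0))$ for all $t\ge0$.
   Context: Let $I$ be a finite set of $N$ nodes. For each $t\in\mathbb{Z}_{\ge0}$ let $A(t)=(a_{ij}(t))_{i,j\in I}$ be a random matrix with $a_{ij}(t)\ge 0$ and $\sum_{\ell\in I}a_{i\ell}(t)=1$ for all $i$; the matrices $A(t)$ are i.i.d. in $t$. $L(t)$ is the Laplacian: $L_{ij}(t)=-a_{ij}(t)$ for $i\ne j$, $L_{ii}(t)=\sum_{j\ne i}a_{ij}(t)$. $x(0)\in\mathbb{R}^I$ is deterministic. $\mathbf{1}$ is the all-ones vector, $M^*$ the transpose; for $y\in\mathbb{R}^I$, $\bar y=\frac1N\sum_i y_i$, $V(y)=\frac1N\sum_i(y_i-\bar y)^2$. For square matrices, $A\le B$ means $A-B$ is negative semidefinite. *)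

(* Defs.v *)
From HB Require Import structures.
From mathcomp Require Import all_boot all_order all_algebra.
From mathcomp Require Import all_classical all_reals all_analysis.
Set Implicit Arguments. Unset Strict Implicit. Unset Printing Implicit Defensive.
Import Order.TTheory GRing.Theory Num.Theory.
Local Open Scope classical_set_scope.
Local Open Scope ring_scope.

Section Defs.
Context {d : measure_display} {T : measurableType d} {R : realType}.
Variable P : probability T R.
Variable N : nat.

Definition lap (M : 'M[R]_N) : 'M[R]_N :=
  \matrix_(i, j) if i == j then \sum_(k | k != i) M i k else - M i j.

Definition ones : 'cV[R]_N := const_mx 1.

Definition Emx m n (X : T -> 'M[R]_(m, n)) : 'M[R]_(m, n) :=
  \matrix_(i, j) fine ('E_P[fun w => X w i j]).

Definition nsd (M : 'M[R]_N) : Prop :=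
  forall v : 'cV[R]_N, (v^T *m M *m v) ord0 ord0 <= 0.
Definition leqmx (A B : 'M[R]_N) : Prop := nsd (A - B).

Definition mean (y : 'cV[R]_N) : R := (\sum_i y i ord0) / N%:R.
Definition var (y : 'cV[R]_N) : R := (\sum_i (y i ord0 - mean y) ^+ 2) / N%:R.

Fixpoint traj (A : nat -> T -> 'M[R]_N) (x0 : 'cV[R]_N) (t : nat) (w : T)
  : 'cV[R]_N :=
  match t with
  | 0 => x0
  | t'.+1 => traj A x0 t' w - lap (A t' w) *m traj A x0 t' w
  end.

Definition rmx_measurable (A : nat -> T -> 'M[R]_N) : Prop :=
  forall t (i j : 'I_N), measurable_fun setT (fun w => A t w i j).

(* mutual independence of the family (A(t))_t: the product rule over every
   finite set of distinct times, for the generating pi-system of events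
   {forall i j, A(t) i j \in B i j} with B i j Borel sets *)
Definition indep_mx_seq (A : nat -> T -> 'M[R]_N) : Prop :=
  forall (s : seq nat), uniq s ->
  forall B : nat -> 'I_N -> 'I_N -> set R,
    (forall t i j, measurable (B t i j)) ->
    P [set w | forall t, t \in s -> forall i j, B t i j (A t w i j)] =
    (\prod_(t <- s) P [set w | forall i j, B t i j (A t w i j)])%E.

Definition ident_distr_mx (A : nat -> T -> 'M[R]_N) : Prop :=
  forall t (B : 'I_N -> 'I_N -> set R), (forall i j, measurable (B i j)) ->
    P [set w | forall i j, B i j (A t w i j)] =
    P [set w | forall i j, B i j (A 0%N w i j)].

End Defs.

(* Main.v *)
Require Import Defs.
From HB Require Import structures.
From mathcomp Require Import all_boot all_order all_algebra.
From mathcomp Require Import all_classical all_reals all_analysis.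
From mathcomp Require Import measurable_realfun ring lra.
Import Order.TTheory GRing.Theory Num.Theory.
Local Open Scope ring_scope.

(** Write [g_i = (L v)_i] for a deterministic vector [v].  The sum of the [g_i]
    has mean zero and they are pairwise uncorrelated, so the second moment of
    their sum is at most the sum of their second moments.  Row by row, with
    [S_i] the sum of the [a_ij (v_i - v_j)^2], Cauchy-Schwarz gives
    [g_i^2 <= amax S_i] and [g_i^2 <= (1 - alpha) S_i], hence
    [g_i^2 <= gamma (S_i - g_i^2)]; and [v^* (L + L^* - L^* L) v] has the same
    mean as the sum of the [S_i - g_i^2], because [1^* E(L) = 0].

    For the second claim let [z(t) = x(t) - mean x(0)].  The first claim says
    that [W(z) = (sum_i z_i)^2 + gamma |z|^2] does not increase in mean under a
    step from a deterministic [z], and since [L(t)] is independent of [z(t)]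
    (pi-lambda theorem) the same holds along the random trajectory.  Finally
    [W(z(0)) = gamma N V(x(0))], while [W(z) >= N (N + gamma) m^2] where [m] is
    the mean of [z]. *)

(** The entries of a stochastic matrix lie in [0, 1], so every random quantity below is of this kind
    and integrability needs no separate argument. *)
Definition bmfun {d} {T : measurableType d} {R : realType} (f : T -> R) :=
  measurable_fun setT f /\ exists C : R, forall w, `|f w| <= C.

(** * Closure of bounded measurable functions under algebraic operations *)

Section bounded_measurable.
Context {d : measure_display} {T : measurableType d} {R : realType}.
Implicit Types f g : T -> R.

Lemma bmfun_cst (c : R) : bmfun (fun _ : T => c).
Proof. by split; [exact: measurable_cst | exists `|c|]. Qed.

Lemma bmfunD f g : bmfun f -> bmfun g -> bmfun (fun w => f w + g w).
Proof.
move=> [mf [a fa]] [mg [b gb]]; split; first exact: measurable_funD.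
by exists (a + b) => w; rewrite (le_trans (ler_normD _ _))// lerD.
Qed.

Lemma bmfunM f g : bmfun f -> bmfun g -> bmfun (fun w => f w * g w).
Proof.
move=> [mf [a fa]] [mg [b gb]]; split; first exact: measurable_funM.
by exists (a * b) => w; rewrite normrM ler_pM.
Qed.

Lemma bmfunZ c f : bmfun f -> bmfun (fun w => c * f w).
Proof. exact/bmfunM/bmfun_cst. Qed.

Lemma bmfunN f : bmfun f -> bmfun (fun w => - f w).
Proof.
by move=> /(bmfunZ (-1)); under eq_fun do rewrite mulN1r.
Qed.

Lemma bmfunB f g : bmfun f -> bmfun g -> bmfun (fun w => f w - g w).
Proof. by move=> bf bg; apply: bmfunD => //; exact: bmfunN. Qed.

Lemma bmfunX n f : bmfun f -> bmfun (fun w => f w ^+ n).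
Proof.
move=> bf; elim: n => [|n IHn]; first exact: bmfun_cst.
by under eq_fun do rewrite exprS; exact: bmfunM.
Qed.

Lemma bmfun_sum (I : Type) (r : seq I) (Q : pred I) (F : I -> T -> R) :
  (forall i, Q i -> bmfun (F i)) -> bmfun (fun w => \sum_(i <- r | Q i) F i w).
Proof.
move=> bF; elim: r => [|i r IHr].
  by under eq_fun do rewrite big_nil; exact: bmfun_cst.
under eq_fun do rewrite big_cons.
by case: (boolP (Q i)) => // Qi; apply: bmfunD => //; exact: bF.
Qed.

End bounded_measurable.

(** * Real-valued expectation of bounded functions *)

Section bounded_expectation.
Context {d : measure_display} {T : measurableType d} {R : realType}.
Variable P : probability T R.
Implicit Types f g : T -> R.

Definition Ex f : R := fine ('E_P[f])%E.

Lemma bmfun_integrable f : bmfun f -> P.-integrable setT (EFin \o f).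
Proof.
move=> [mf [C fC]]; apply: measurable_bounded_integrable => //.
  exact: fin_num_fun_lty.
exists C; split; first exact: num_real.
by move=> M CM w _ /=; exact: le_trans (fC w) (ltW CM).
Qed.

(** [fine] would send an infinite expectation to 0; boundedness rules this out. *)
Lemma EFin_Ex f : bmfun f -> ((Ex f)%:E = 'E_P[f])%E.
Proof.
move=> bf; rewrite /Ex fineK// unlock; apply: integrable_fin_num => //.
exact: bmfun_integrable.
Qed.

Lemma ExE f : Ex f = (\int[P]_w f w)%R.
Proof. by rewrite /Ex unlock. Qed.

Lemma Ex_cst (c : R) : Ex (fun _ => c) = c.
Proof. by rewrite /Ex (expectation_cst P c). Qed.

Lemma ExD f g : bmfun f -> bmfun g -> Ex (fun w => f w + g w) = Ex f + Ex g.
Proof.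
by move=> bf bg; rewrite !ExE RintegralD//; exact: bmfun_integrable.
Qed.

Lemma ExB f g : bmfun f -> bmfun g -> Ex (fun w => f w - g w) = Ex f - Ex g.
Proof.
by move=> bf bg; rewrite !ExE RintegralB//; exact: bmfun_integrable.
Qed.

Lemma ExZ c f : bmfun f -> Ex (fun w => c * f w) = c * Ex f.
Proof.
by move=> bf; rewrite !ExE RintegralZl//; exact: bmfun_integrable.
Qed.

Lemma Ex_sum (I : Type) (r : seq I) (Q : pred I) (F : I -> T -> R) :
  (forall i, Q i -> bmfun (F i)) ->
  Ex (fun w => \sum_(i <- r | Q i) F i w) = \sum_(i <- r | Q i) Ex (F i).
Proof.
move=> bF; elim: r => [|i r IHr].
  by under eq_fun do rewrite big_nil; rewrite big_nil Ex_cst.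
under eq_fun do rewrite big_cons; rewrite big_cons.
case: (boolP (Q i)) => // Qi; rewrite ExD ?IHr//; [exact: bF|exact: bmfun_sum].
Qed.

(** [expectation_le] compares nonnegative functions, so both sides are first shifted by the sum
    [a + b] of their bounds. *)
Lemma le_Ex f g : bmfun f -> bmfun g -> {ae P, forall w, f w <= g w} ->
  Ex f <= Ex g.
Proof.
move=> bf bg fg; have [mf [a fa]] := bf; have [mg [b gb]] := bg.
have bD (h : T -> R) : bmfun h -> bmfun (fun w => h w + (a + b)).
  by move=> bh; apply: bmfunD => //; exact: bmfun_cst.
have nneg (w : T) : 0 <= a /\ 0 <= b.
  split; first exact: le_trans (normr_ge0 _) (fa w).
  exact: le_trans (normr_ge0 _) (gb w).
suff : Ex (fun w => f w + (a + b)) <= Ex (fun w => g w + (a + b)).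
  by rewrite !ExD ?lerD2r//; exact: bmfun_cst.
rewrite -lee_fin !EFin_Ex; [|exact: bD..].
apply: expectation_le; [exact: (bD _ bf).1|exact: (bD _ bg).1| | |].
- move=> w; have [_ b0] := nneg w; move: (fa w).
  by rewrite ler_norml => /andP[aw _]; rewrite addrA addr_ge0// -lerBlDr sub0r.
- move=> w; have [a0 _] := nneg w; move: (gb w).
  by rewrite ler_norml => /andP[bw _]; rewrite addrCA addr_ge0// -lerBlDr sub0r.
- by apply: filterS fg => w; rewrite lerD2r.
Qed.

End bounded_expectation.

(** * Independence of generated sigma-algebras *)

Section independence.
Local Open Scope classical_set_scope.
Context {d : measure_display} {T : measurableType d} {R : realType}.
Variable P : probability T R.

Definition indep_sets (C D : set (set T)) :=
  forall X Y, C X -> D Y -> P (X `&` Y) = (P X * P Y)%E.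

Lemma indep_sets_sym C D : indep_sets C D -> indep_sets D C.
Proof. by move=> CD X Y DX CY; rewrite setIC CD// muleC. Qed.

(** Pi-lambda argument: for a fixed [Y], the measurable [X] obeying the product rule form a
    lambda-system [H] containing the pi-system [C]. *)
Lemma indep_sets_g_sigma_algebra C D : setI_closed C -> C `<=` measurable ->
  D `<=` measurable -> indep_sets C D -> indep_sets <<s C >> D.
Proof.
move=> CI mC mD CD X Y + DY; move: X.
pose H := [set X : set T | measurable X /\ P (X `&` Y) = (P X * P Y)%E].
suff CH : <<s C >> `<=` H by move=> X /CH[].
have mY := mD _ DY.
have PYfin : P Y \is a fin_num by exact: fin_num_measure.
apply: lambda_system_subset => //; last first.
  by move=> X CX; split; [exact: mC | exact: CD].
split=> //.
- by split; [exact: measurableT | rewrite setTI probability_setT mul1e].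
- move=> X1 X2 X21 [mX1 E1] [mX2 E2]; split; first exact: measurableD.
  have fin X : measurable X -> (P X < +oo)%E.
    by move=> mX; rewrite ltey_eq fin_num_measure.
  have -> : (X1 `\` X2) `&` Y = (X1 `&` Y) `\` (X2 `&` Y).
    by apply/seteqP; split=> x /=; tauto.
  rewrite !measureD//; last 4 first.
    + exact: fin.
    + exact: measurableI.
    + exact: measurableI.
    + by apply: fin; exact: measurableI.
  rewrite (setIidr (setSI (C := Y) X21)).
  rewrite (setIidr X21) /= E1 E2 muleBl ?fin_num_adde_defr ?fin_num_measure//.
- move=> F ndF HF; have mF k : measurable (F k) by have [] := HF k.
  split; first exact: bigcup_measurable.
  (* Continuity from below, for [F k] and for its trace on [Y]; the product rule passes to the
     limit. *)
  have cF : P (F k) @[k --> \oo] --> P (\bigcup_k F k).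
    by apply: nondecreasing_cvg_mu => //; exact: bigcup_measurable.
  have cFY : (P (F k) * P Y)%E @[k --> \oo] --> P (\bigcup_k F k `&` Y).
    have -> : (fun k => (P (F k) * P Y)%E) = P \o (fun k => F k `&` Y).
      by apply/funext => k; rewrite -(HF k).2.
    rewrite setI_bigcupl; apply: nondecreasing_cvg_mu.
    + by move=> k; exact: measurableI.
    + by apply: bigcup_measurable => k _; exact: measurableI.
    + by move=> m n mn; apply/subsetPset; apply: setSI; apply/subsetPset/ndF.
  apply: (cvg_unique (@ereal_hausdorff R) cFY).
  exact: cvgeZr.
Qed.

(** The one-sided extension is used twice: for [C] against [D], then, by symmetry, for [D] against
    the sigma-algebra of [C]. *)
Lemma indep_sets_g_sigma_algebra2 C D : setI_closed C -> setI_closed D ->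
  C `<=` measurable -> D `<=` measurable -> indep_sets C D ->
  indep_sets <<s C >> <<s D >>.
Proof.
move=> CI DI mC mD CD.
have msD : <<s C >> `<=` measurable.
  by apply: smallest_sub => //; exact: sigma_algebra_measurable.
apply: indep_sets_sym; apply: indep_sets_g_sigma_algebra => //.
by apply: indep_sets_sym; exact: indep_sets_g_sigma_algebra.
Qed.

End independence.

(** * Expectation of a product of independent functions *)

Section product_rule.
Local Open Scope classical_set_scope.
Context {d : measure_display} {T : measurableType d} {R : realType}.
Variable P : probability T R.

Definition indep_fun (X Y : T -> R) := forall B C : set R,
  measurable B -> measurable C ->
  P (X @^-1` B `&` Y @^-1` C) = (P (X @^-1` B) * P (Y @^-1` C))%E.

(** By independence the law of the pair is the product of the two laws, and Tonelli splits the
    integral. *)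
Lemma ge0_expectationM (X Y : T -> R) :
  measurable_fun setT X -> measurable_fun setT Y ->
  (forall w, 0 <= X w) -> (forall w, 0 <= Y w) -> indep_fun X Y ->
  ('E_P[fun w => (X w * Y w)%R] = 'E_P[X] * 'E_P[Y])%E.
Proof.
move=> mX mY X0 Y0 XY.
pose X' : {mfun T >-> R} := HB.pack X (isMeasurableFun.Build _ _ _ _ X mX).
pose Y' : {mfun T >-> R} := HB.pack Y (isMeasurableFun.Build _ _ _ _ Y mY).
pose Z w := (X w, Y w).
have mZ : measurable_fun setT Z by exact: measurable_fun_pair.
pose Z' : {mfun T >-> (R * R)%type} :=
  HB.pack Z (isMeasurableFun.Build _ _ _ _ Z mZ).
pose m1 := distribution P X'; pose m2 := distribution P Y'.
(* Absolute values make the integrand nonnegative on the whole plane; on the range of [Z] they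
   change nothing. *)
pose f (z : R * R) := (`|z.1| * `|z.2|)%:E.
have mn : measurable_fun setT (fun x : R => `|x|%:E).
  by apply/measurable_EFinP; exact: normr_measurable.
have mf : measurable_fun setT f.
  have mnorm := @normr_measurable R setT.
  apply/measurable_EFinP; apply: measurable_funM.
    exact: (measurableT_comp mnorm (@measurable_fst _ _ _ _)).
  exact: (measurableT_comp mnorm (@measurable_snd _ _ _ _)).
have f0 z : (0 <= f z)%E by rewrite lee_fin mulr_ge0.
have intE (U : T -> R) (mU : measurable_fun setT U) : (forall w, 0 <= U w) ->
    ('E_P[U] = \int[pushforward P U]_x `|x|%:E)%E.
  move=> U0; rewrite ge0_integral_pushforward// unlock preimage_setT.
  by apply: eq_integral => w _ /=; rewrite ger0_norm.
transitivity (\int[distribution P Z']_z f z)%E.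
  rewrite ge0_integral_pushforward// unlock preimage_setT.
  by apply: eq_integral => w _ /=; rewrite /f /= !ger0_norm.
transitivity (\int[m1 \x m2]_z f z)%E.
  apply: eq_measure_integral => B mB _.
  (* It is enough to compare the two measures on rectangles, where this is the independence
     hypothesis. *)
  by apply/esym/(product_measure_unique (m1 := m1) (m2 := m2)) => // C D;
    exact: XY.
rewrite fubini_tonelli1//= /fubini_F.
under eq_integral do rewrite /f/=.
transitivity (\int[m1]_x (`|x|%:E * \int[m2]_y `|y|%:E))%E.
  apply: eq_integral => x _; under eq_integral do rewrite EFinM.
  by rewrite ge0_integralZl_EFin.
by rewrite ge0_integralZr ?integral_ge0 ?intE.
Qed.

(** Adding the bounds [a] and [b] reduces to the nonnegative case and preserves independence; by
    linearity the extra terms cancel. *)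
Lemma ExM_indep (X Y : T -> R) : bmfun X -> bmfun Y -> indep_fun X Y ->
  Ex P (fun w => X w * Y w) = Ex P X * Ex P Y.
Proof.
move=> bX bY XY; have [mX [a Xa]] := bX; have [mY [b Yb]] := bY.
have bXa : bmfun (fun w => X w + a) by apply: bmfunD => //; exact: bmfun_cst.
have bYb : bmfun (fun w => Y w + b) by apply: bmfunD => //; exact: bmfun_cst.
have : Ex P (fun w => (X w + a) * (Y w + b)) =
    Ex P (fun w => X w + a) * Ex P (fun w => Y w + b).
  apply: EFin_inj; rewrite EFinM !EFin_Ex//; last exact: bmfunM.
  apply: ge0_expectationM; [exact: bXa.1|exact: bYb.1| | |].
  - by move=> w; move: (Xa w); rewrite ler_norml -lerBlDr sub0r => /andP[].
  - by move=> w; move: (Yb w); rewrite ler_norml -lerBlDr sub0r => /andP[].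
  - have mD c (B : set R) : measurable B -> measurable ((+%R^~ c) @^-1` B).
      move=> mB; rewrite -[X in measurable X]setTI.
      by apply: (measurable_funD (@measurable_id _ _ _) (measurable_cst c)).
    by move=> B C mB mC; exact: (XY _ _ (mD a _ mB) (mD b _ mC)).
have -> : (fun w => (X w + a) * (Y w + b)) =
    (fun w => X w * Y w + b * X w + a * Y w + a * b).
  by apply/funext => w; ring.
rewrite !ExD ?ExZ ?Ex_cst//;
  do ?[exact: bmfun_cst|exact: bmfunZ|exact: bmfunM|apply: bmfunD].
move=> /eqP; rewrite -subr_eq0 => /eqP E.
by apply/eqP; rewrite -subr_eq0 -E; apply/eqP; ring.
Qed.

End product_rule.

(** * Independence of functions of the matrices at disjoint sets of times *)

Section past_and_future.
Local Open Scope classical_set_scope.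
Context {d : measure_display} {T : measurableType d} {R : realType}.
Context {N : nat}.
Variables (P : probability T R) (A : nat -> T -> 'M[R]_N).
Hypothesis mA : rmx_measurable A.
Hypothesis indepA : indep_mx_seq P A.

(** The pi-system of [indep_mx_seq], generating the sigma-algebra of the [A t] with [t] in [s]; the
    values of [B] at other times are irrelevant. *)
Definition cylinders (s : seq nat) : set (set T) :=
  [set X | exists2 B : nat -> 'I_N -> 'I_N -> set R,
    (forall t i j, measurable (B t i j)) &
    X = [set w | forall t, t \in s -> forall i j, B t i j (A t w i j)]].

Lemma cylinders_setI s : setI_closed (cylinders s).
Proof.
move=> _ _ [B mB ->] [C mC ->].
exists (fun t i j => B t i j `&` C t i j) => [t i j|]; first exact: measurableI.
apply/seteqP; split=> w /=.
  by move=> [Bw Cw] t ts i j; split; [exact: Bw|exact: Cw].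
by move=> BCw; split=> t ts i j; have [] := BCw t ts i j.
Qed.

Lemma cylinders_measurable s : cylinders s `<=` measurable.
Proof.
move=> _ [B mB ->].
have -> : [set w | forall t, t \in s -> forall i j, B t i j (A t w i j)] =
    \bigcap_(t in [set` s]) \bigcap_(p : 'I_N * 'I_N)
      ((fun w => A t w p.1 p.2) @^-1` B t p.1 p.2).
  apply/seteqP; split=> w /= H.
    by move=> t ts [i j] _; exact: H.
  by move=> t ts i j; exact: (H t ts (i, j)).
apply: fin_bigcap_measurable => [|t _]; first exact: finite_seq.
apply: fin_bigcap_measurable => [|p _]; first exact: finite_finset.
by rewrite -[X in measurable X]setTI; exact: mA.
Qed.

(** Two cylinders over disjoint times meet in one cylinder over [s1 ++ s2], with sides [D]; its
    product of probabilities splits along the concatenation. *)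
Lemma indep_cylinders s1 s2 : uniq (s1 ++ s2) ->
  indep_sets P (cylinders s1) (cylinders s2).
Proof.
rewrite cat_uniq => /and3P[u1 /hasPn s12 u2] _ _ [B mB ->] [C mC ->].
rewrite !indepA//.
pose D t := if t \in s1 then B t else C t.
have mD t i j : measurable (D t i j) by rewrite /D; case: ifP.
transitivity (P [set w | forall t, t \in s1 ++ s2 ->
    forall i j, D t i j (A t w i j)]).
  congr (P _); apply/seteqP; split=> w /=.
    move=> [Bw Cw] t; rewrite mem_cat /D.
    case: ifP => /= ts1 ts2; first exact: Bw.
    exact: Cw.
  move=> Dw; split=> t ts i j.
    by have := Dw t; rewrite mem_cat /D ts; apply.
  have := Dw t; rewrite mem_cat /D ts orbT (negbTE (s12 _ ts)); exact.
rewrite indepA ?cat_uniq ?u1 ?u2 ?andbT//=; last exact/hasPn.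
rewrite big_cat/=; congr (_ * _)%E; apply: eq_big_seq => t ts; rewrite /D ?ts//.
by rewrite (negbTE (s12 _ ts)).
Qed.

Lemma measurable_entry_cylinders s t i j : t \in s ->
  measurable_fun setT
    (fun w : g_sigma_algebraType (cylinders s) => A t w i j : R).
Proof.
move=> ts _ C mC; rewrite setTI; apply: sub_sigma_algebra.
(* Only the entry [(t, i, j)] is constrained. *)
exists (fun t' i' j' => if (t', i', j') == (t, i, j) then C else setT).
  by move=> t' i' j'; case: ifP.
apply/seteqP; split=> w /=.
  by move=> Cw t' ts' i' j'; case: eqP => // -[-> -> ->].
by move=> /(_ t ts i j); rewrite eqxx.
Qed.

Lemma bmfun_cylinders s (f : T -> R) :
  bmfun (f : g_sigma_algebraType (cylinders s) -> R) -> bmfun f.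
Proof.
move=> [mf bf]; split=> // _ C mC; have := mf measurableT C mC.
apply: smallest_sub; first exact: sigma_algebra_measurable.
exact: cylinders_measurable.
Qed.

(** The form in which independence is used: [s1] will be the times before [t], and [s2] the time [t]
    alone. *)
Lemma ExM_cylinders s1 s2 (f g : T -> R) : uniq (s1 ++ s2) ->
  bmfun (f : g_sigma_algebraType (cylinders s1) -> R) ->
  bmfun (g : g_sigma_algebraType (cylinders s2) -> R) ->
  Ex P (fun w => f w * g w) = Ex P f * Ex P g.
Proof.
move=> us bf bg; apply: ExM_indep.
- exact: bmfun_cylinders bf.
- exact: bmfun_cylinders bg.
move=> B C mB mC.
apply: (indep_sets_g_sigma_algebra2 P (cylinders s1) (cylinders s2)).
- exact: cylinders_setI.
- exact: cylinders_setI.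
- exact: cylinders_measurable.
- exact: cylinders_measurable.
- exact: indep_cylinders.
- by rewrite -[X in _ X]setTI; exact: bf.1.
- by rewrite -[X in _ X]setTI; exact: bg.1.
Qed.

End past_and_future.

(** * Boundedness and measurability of trajectories *)

Section trajectories.
Context {d : measure_display} {T : measurableType d} {R : realType} {N : nat}.

Lemma bmfun_lap (M : T -> 'M[R]_N) :
  (forall i j, bmfun (fun w => M w i j)) ->
  forall i j, bmfun (fun w => lap (M w) i j).
Proof.
move=> bM i j; under eq_fun do rewrite mxE.
by case: eqP => _; [exact: bmfun_sum|exact: bmfunN].
Qed.

(** Only times before [t] are assumed measurable, so that the lemma also applies on [T] with the
    smaller sigma-algebra of the past. *)
Lemma bmfun_traj (A : nat -> T -> 'M[R]_N) (x0 : 'cV[R]_N) t :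
  (forall s i j, (s < t)%N -> bmfun (fun w => A s w i j)) ->
  forall i, bmfun (fun w => traj A x0 t w i ord0).
Proof.
elim: t => [|t IHt] bA i; first exact: bmfun_cst.
have bx : forall i, bmfun (fun w => traj A x0 t w i ord0).
  by apply: IHt => s k l st; apply: bA; rewrite ltnW.
rewrite /=; under eq_fun do rewrite !mxE.
apply: bmfunB => //; apply: bmfun_sum => k _; apply: bmfunM => //.
by apply: bmfun_lap => k' l'; exact: bA.
Qed.

End trajectories.

(** Lagrange's identity: the double sum of the [a i * a j * (x i - x j) ^+ 2] is twice the
    difference of the two sides. *)
Lemma weighted_cauchy_schwarz (R : realFieldType) (I : finType) (Q : pred I)
    (a x : I -> R) : (forall i, Q i -> 0 <= a i) ->
  (\sum_(i | Q i) a i * x i) ^+ 2 <=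
    (\sum_(i | Q i) a i) * \sum_(i | Q i) a i * x i ^+ 2.
Proof.
move=> a0.
pose p := \sum_(i | Q i) a i; pose m := \sum_(i | Q i) a i * x i.
pose S := \sum_(i | Q i) a i * x i ^+ 2.
have : 0 <= \sum_(i | Q i) \sum_(j | Q j) a i * a j * (x i - x j) ^+ 2.
  apply: sumr_ge0 => i Qi; apply: sumr_ge0 => j Qj.
  by rewrite mulr_ge0 ?sqr_ge0// mulr_ge0 ?a0.
have -> : \sum_(i | Q i) \sum_(j | Q j) a i * a j * (x i - x j) ^+ 2 =
    \sum_(i | Q i) (p * (a i * x i ^+ 2) - 2 * m * (a i * x i) + S * a i).
  apply: eq_bigr => i _.
  rewrite /p /m /S mulr_sumr !mulr_suml -sumrB -big_split/=.
  by apply: eq_bigr => j _; ring.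
rewrite big_split/= sumrB -!mulr_sumr -/p -/m -/S.
by move: p m S => p m S; nra.
Qed.

(** * Quadratic forms of the Laplacian *)

Section laplacian.
Context {R : realType} {N : nat}.
Implicit Types (M : 'M[R]_N) (v : 'cV[R]_N).

Definition qf M v : R := (v^T *m M *m v) ord0 ord0.

Lemma qfE M v : qf M v = \sum_i \sum_j (v i ord0 * v j ord0) * M i j.
Proof.
rewrite /qf mxE exchange_big/=; apply: eq_bigr => j _; rewrite mxE mulr_suml.
by apply: eq_bigr => i _; rewrite mxE; ring.
Qed.

Lemma lap_mulE M v i :
  (lap M *m v) i ord0 = \sum_(j | j != i) M i j * (v i ord0 - v j ord0).
Proof.
rewrite mxE (bigD1 i)//= mxE eqxx mulr_suml -big_split/=.
apply: eq_bigr => j ji; rewrite mxE eq_sym (negbTE ji); ring.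
Qed.

(** This makes a trajectory centred by a constant obey the same recursion. *)
Lemma lap_mul_const M (c : R) : lap M *m const_mx c = 0 :> 'cV_N.
Proof.
apply/matrixP => i j; rewrite [j]ord1 lap_mulE big1 ?mxE// => k _.
by rewrite !mxE subrr mulr0.
Qed.

Lemma onesT_mul v : ((ones N)^T *m v) ord0 ord0 = \sum_i v i ord0.
Proof. by rewrite mxE; apply: eq_bigr => i _; rewrite !mxE mul1r. Qed.

Lemma qf_trmul_ones L v :
  qf (L^T *m ones N *m (ones N)^T *m L) v = (\sum_i (L *m v) i ord0) ^+ 2.
Proof.
have E : v^T *m (L^T *m ones N *m (ones N)^T *m L) *m v =
    ((ones N)^T *m (L *m v))^T *m ((ones N)^T *m (L *m v)).
  by rewrite !trmx_mul trmxK !mulmxA.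
by rewrite /qf E mxE big_ord1 [X in X * _]mxE onesT_mul expr2.
Qed.

Lemma qf_sym_lap L v :
  qf (L + L^T - L^T *m L) v =
  2 * (\sum_i v i ord0 * (L *m v) i ord0) - \sum_i (L *m v) i ord0 ^+ 2.
Proof.
have E1 : qf L v = \sum_i v i ord0 * (L *m v) i ord0.
  by rewrite /qf -mulmxA mxE; apply: eq_bigr => i _; rewrite mxE.
have E2 : qf L^T v = qf L v.
  rewrite !qfE exchange_big; apply: eq_bigr => i _; apply: eq_bigr => j _.
  by rewrite mxE (mulrC (v j _)).
have E3 : qf (L^T *m L) v = \sum_i (L *m v) i ord0 ^+ 2.
  rewrite /qf mulmxA -trmx_mul -mulmxA mxE; apply: eq_bigr => i _.
  by rewrite mxE expr2.
have -> : qf (L + L^T - L^T *m L) v = qf L v + qf L^T v - qf (L^T *m L) v.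
  by rewrite /qf mulmxBr mulmxBl mulmxDr mulmxDl !mxE.
by rewrite E2 E1 E3 mulr_natl mulr2n.
Qed.

(* The matrix of the quadratic form [W] of the header. *)
Definition lyapunov (g : R) : 'M[R]_N := ones N *m (ones N)^T + g%:M.

Lemma qf_lyapunov g v :
  qf (lyapunov g) v = (\sum_i v i ord0) ^+ 2 + g * \sum_i v i ord0 ^+ 2.
Proof.
have E1 : qf (ones N *m (ones N)^T) v = (\sum_i v i ord0) ^+ 2.
  rewrite -[in RHS](mul1mx v) -qf_trmul_ones trmx1 mul1mx mulmx1//.
have -> : qf (lyapunov g) v = qf (ones N *m (ones N)^T) v + qf g%:M v.
  by rewrite /qf mulmxDr mulmxDl mxE.
rewrite E1; congr (_ + _).
rewrite /qf mul_mx_scalar -scalemxAl mxE; congr (_ * _).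
by rewrite mxE; apply: eq_bigr => i _; rewrite mxE expr2.
Qed.

Lemma qf_congr M L v : qf (L^T *m M *m L) v = qf M (L *m v).
Proof. by rewrite /qf trmx_mul !mulmxA. Qed.

End laplacian.

(** * Random matrices and expectations of their quadratic forms *)

Definition bmmx {d} {T : measurableType d} {R : realType} {m n}
  (M : T -> 'M[R]_(m, n)) := forall i j, bmfun (fun w => M w i j).

Section bounded_measurable_matrices.
Context {d : measure_display} {T : measurableType d} {R : realType}.

Lemma bmmx_cst m n (M : 'M[R]_(m, n)) : bmmx (fun _ : T => M).
Proof. by move=> i j; exact: bmfun_cst. Qed.

Lemma bmmxD m n (L M : T -> 'M[R]_(m, n)) :
  bmmx L -> bmmx M -> bmmx (fun w => L w + M w).
Proof. by move=> bL bM i j; under eq_fun do rewrite mxE; exact: bmfunD. Qed.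

Lemma bmmxB m n (L M : T -> 'M[R]_(m, n)) :
  bmmx L -> bmmx M -> bmmx (fun w => L w - M w).
Proof. by move=> bL bM i j; under eq_fun do rewrite !mxE; exact: bmfunB. Qed.

Lemma bmmxM m n p (L : T -> 'M[R]_(m, n)) (M : T -> 'M[R]_(n, p)) :
  bmmx L -> bmmx M -> bmmx (fun w => L w *m M w).
Proof.
move=> bL bM i j; under eq_fun do rewrite mxE.
by apply: bmfun_sum => k _; exact: bmfunM.
Qed.

Lemma bmmx_tr m n (M : T -> 'M[R]_(m, n)) : bmmx M -> bmmx (fun w => (M w)^T).
Proof. by move=> bM i j; under eq_fun do rewrite mxE; exact: bM. Qed.

Lemma bmfun_qf {N} (M : T -> 'M[R]_N) (Z : T -> 'cV[R]_N) :
  bmmx M -> bmmx Z -> bmfun (fun w => qf (M w) (Z w)).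
Proof.
by move=> bM bZ; apply: bmmxM => //; apply: bmmxM => //; exact: bmmx_tr.
Qed.

Variable P : probability T R.

(** The product hypothesis covers both a constant [Z] and a [Z] independent of [M]; expanding the
    form into monomials, it replaces [M] by its mean and keeps [Z] random. *)
Lemma Ex_qf {N} (M : T -> 'M[R]_N) (Z : T -> 'cV[R]_N) :
  bmmx M -> bmmx Z ->
  (forall i j, Ex P (fun w => Z w i ord0 * Z w j ord0 * M w i j) =
    Ex P (fun w => Z w i ord0 * Z w j ord0) * Ex P (fun w => M w i j)) ->
  Ex P (fun w => qf (M w) (Z w)) = Ex P (fun w => qf (Emx P M) (Z w)).
Proof.
move=> bM bZ MZ; under eq_fun do rewrite qfE.
under [in RHS]eq_fun do rewrite qfE.
have bZZ i j : bmfun (fun w => Z w i ord0 * Z w j ord0) by exact: bmfunM.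
rewrite !Ex_sum; try by move=> i _; apply: bmfun_sum => j _;
  apply: bmfunM => //; exact: bmfun_cst.
apply: eq_bigr => i _; rewrite !Ex_sum;
  try by move=> j _; apply: bmfunM => //; exact: bmfun_cst.
apply: eq_bigr => j _; rewrite MZ mxE.
by under [in RHS]eq_fun do rewrite mulrC; rewrite ExZ// mulrC.
Qed.

Lemma qf_Emx {N} (M : T -> 'M[R]_N) (v : 'cV[R]_N) : bmmx M ->
  qf (Emx P M) v = Ex P (fun w => qf (M w) v).
Proof.
move=> bM; rewrite (Ex_qf M (fun=> v)) ?Ex_cst//; first exact: bmmx_cst.
by move=> i j; rewrite ExZ// Ex_cst.
Qed.

End bounded_measurable_matrices.

(** * One step from a deterministic vector *)

Section one_step.
Context {d : measure_display} {T : measurableType d} {R : realType}.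
Context {N : nat}.
Variables (P : probability T R) (M : T -> 'M[R]_N) (amax alpha : R).
Hypothesis bM : bmmx M.
Hypothesis M_ge0 : forall w i j, 0 <= M w i j.
Hypothesis M_sum1 : forall w i, \sum_j M w i j = 1.
Hypothesis M_mean0 : (ones N)^T *m Emx P (fun w => lap (M w)) = 0.
Hypothesis alpha_gt0 : 0 < alpha.
Hypothesis M_bounds : {ae P, forall w, forall i : 'I_N,
  \sum_(j | j != i) M w i j <= amax /\ alpha <= M w i i}.
Hypothesis M_uncorr : forall i j k l : 'I_N, i != k ->
  Ex P (fun w => M w i j * M w k l) =
  Ex P (fun w => M w i j) * Ex P (fun w => M w k l).

Let bL : bmmx (fun w => lap (M w)). Proof. exact: bmfun_lap. Qed.
Let g (v : 'cV[R]_N) (i : 'I_N) (w : T) : R := (lap (M w) *m v) i ord0.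
Let bg v i : bmfun (g v i).
Proof. by apply: bmmxM => //; exact: bmmx_cst. Qed.

Lemma Ex_sum_lap v : \sum_i Ex P (g v i) = 0.
Proof.
have /matrixP/(_ ord0 ord0) : (ones N)^T *m Emx P (fun w => lap (M w)) *m v = 0.
  by rewrite M_mean0 mul0mx.
rewrite -mulmxA onesT_mul [RHS]mxE => E0; rewrite -[RHS]E0.
apply: eq_bigr => i _.
rewrite /g mxE; under eq_fun do rewrite mxE.
rewrite Ex_sum => [|j _]; last by apply: bmfunM => //; exact: bmfun_cst.
apply: eq_bigr => j _; rewrite mxE; under eq_fun do rewrite mulrC.
by rewrite ExZ// mulrC.
Qed.

(** [g v i] is linear in the entries of row [i] alone, so the uncorrelatedness of distinct rows
    extends by bilinearity. *)
Lemma Ex_lap_uncorr v i k : i != k ->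
  Ex P (fun w => g v i w * g v k w) = Ex P (g v i) * Ex P (g v k).
Proof.
move=> ik.
have gE l :
    g v l = (fun w => \sum_(j | j != l) (v l ord0 - v j ord0) * M w l j).
  apply/funext => w; rewrite /g lap_mulE; apply: eq_bigr => j _; exact: mulrC.
have ExgE l : Ex P (g v l) =
    \sum_(j | j != l) (v l ord0 - v j ord0) * Ex P (fun w => M w l j).
  rewrite gE Ex_sum => [|j _]; last exact: bmfunZ.
  by apply: eq_bigr => j _; rewrite ExZ.
transitivity (\sum_(j | j != i) (v i ord0 - v j ord0) *
    Ex P (fun w => M w i j * g v k w)).
  under eq_fun do rewrite gE mulr_suml.
  rewrite Ex_sum => [|j _]; last by apply: bmfunM => //; exact: bmfunZ.
  apply: eq_bigr => j _; under eq_fun do rewrite -mulrA.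
  by rewrite ExZ//; exact: bmfunM.
rewrite ExgE mulr_suml; apply: eq_bigr => j _; rewrite -mulrA; congr (_ * _).
rewrite ExgE gE mulr_sumr; under eq_fun do rewrite mulr_sumr.
rewrite Ex_sum => [|l _]; last by apply: bmfunM => //; exact: bmfunZ.
apply: eq_bigr => l _; under eq_fun do rewrite mulrCA.
by rewrite ExZ ?M_uncorr// 1?mulrCA//; exact: bmfunM.
Qed.

(** The variance of a sum of uncorrelated terms is the sum of their variances, each at most a second
    moment; the sum has mean zero, so its second moment is its variance. *)
Lemma Ex_sqr_sum_lap_le v :
  Ex P (fun w => (\sum_i g v i w) ^+ 2) <= \sum_i Ex P (fun w => g v i w ^+ 2).
Proof.
have -> : Ex P (fun w => (\sum_i g v i w) ^+ 2) =
    \sum_i \sum_k Ex P (fun w => g v i w * g v k w).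
  under eq_fun do rewrite expr2 mulr_suml.
  rewrite Ex_sum => [|i _]; last by apply: bmfunM => //; exact: bmfun_sum.
  apply: eq_bigr => i _; under eq_fun do rewrite mulr_sumr.
  by rewrite Ex_sum// => k _; exact: bmfunM.
have -> : \sum_i \sum_k Ex P (fun w => g v i w * g v k w) =
    \sum_i (Ex P (fun w => g v i w ^+ 2) - Ex P (g v i) ^+ 2).
  (* The added term vanishes by [Ex_sum_lap]; its [k = i] part cancels the squared mean and the rest
     are the off-diagonal products. *)
  transitivity (\sum_i (Ex P (fun w => g v i w ^+ 2) - Ex P (g v i) ^+ 2
      + Ex P (g v i) * \sum_k Ex P (g v k))).
    apply: eq_bigr => i _.
    rewrite mulr_sumr (bigD1 i)//= [in RHS](bigD1 i)//= -expr2 addrA subrK.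
    congr (_ + _); apply: eq_bigr => k ki; apply: Ex_lap_uncorr.
    by rewrite eq_sym.
  by apply: eq_bigr => i _; rewrite Ex_sum_lap mulr0 addr0.
by apply: ler_sum => i _; rewrite lerBlDr lerDl sqr_ge0.
Qed.

Let S (v : 'cV[R]_N) (i : 'I_N) (w : T) : R :=
  \sum_(j | j != i) M w i j * (v i ord0 - v j ord0) ^+ 2.
Let bS v i : bmfun (S v i).
Proof. by apply: bmfun_sum => j _; apply: bmfunM => //; exact: bmfun_cst. Qed.

(* [2 v_i (v_i - v_j) = (v_i - v_j)^2 + v_i^2 - v_j^2], and the last two terms
   are the Laplacian of the vector of squares, which has mean zero. *)
Lemma Ex_lap_form (v : 'cV[R]_N) :
  Ex P (fun w => 2 * \sum_i v i ord0 * g v i w) = \sum_i Ex P (S v i).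
Proof.
pose v2 : 'cV[R]_N := \col_i v i ord0 ^+ 2.
have -> : (fun w => 2 * \sum_i v i ord0 * g v i w) =
    (fun w => \sum_i S v i w + \sum_i g v2 i w).
  apply/funext => w; rewrite mulr_sumr -big_split/=; apply: eq_bigr => i _.
  rewrite /g /S !lap_mulE mulrA mulr_sumr -big_split/=; apply: eq_bigr => j _.
  by rewrite !mxE; ring.
rewrite ExD; [|exact: bmfun_sum..]; rewrite !Ex_sum//.
by rewrite Ex_sum_lap addr0.
Qed.

Lemma lap_row_bound v : {ae P, forall w, forall i,
  g v i w ^+ 2 <= amax / alpha * (S v i w - g v i w ^+ 2)}.
Proof.
apply: filterS M_bounds => w Mw i; have [Mi Mii] := Mw i.
have := M_sum1 w i; rewrite (bigD1 i)//= => M1.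
have := @weighted_cauchy_schwarz R _ [pred j | j != i] (M w i)
  (fun j => v i ord0 - v j ord0) (fun j _ => M_ge0 w i j).
rewrite -lap_mulE -/(g v i w) -/(S v i w) /=.
have S0 : 0 <= S v i w.
  by apply: sumr_ge0 => j _; rewrite mulr_ge0// sqr_ge0.
rewrite mulrAC ler_pdivlMr//.
have p0 : 0 <= \sum_(j | j != i) M w i j by apply: sumr_ge0.
move: (\sum_(j | j != i) M w i j) (S v i w) (g v i w) (M w i i) Mi Mii M1 S0 p0.
move=> p s x a pm aa a1 s0 p0 xs.
have h1 : x ^+ 2 * alpha <= p * s * alpha by rewrite ler_wpM2r// ltW.
(* From [x ^+ 2 <= p * s] and [alpha + p <= a + p = 1]. With [h1] and [p <= amax] this gives
   [x ^+ 2 * alpha <= amax * (s - x ^+ 2)]. *)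
have h2 : alpha * s <= s - x ^+ 2.
  rewrite lerBrDr (le_trans (lerD (lexx _) xs))// -mulrDl ler_piMl//.
  by rewrite -a1 lerD2r.
rewrite (le_trans h1)// -mulrA (mulrC s) ler_pM//.
by rewrite mulr_ge0// ltW.
Qed.

Let M1 w := (lap (M w))^T *m ones N *m (ones N)^T *m lap (M w).
Let M2 w := lap (M w) + (lap (M w))^T - (lap (M w))^T *m lap (M w).

Lemma bmmx_M1 : bmmx M1.
Proof.
apply: bmmxM => //; apply: bmmxM; last exact: bmmx_cst.
by apply: bmmxM; [exact: bmmx_tr|exact: bmmx_cst].
Qed.

Lemma bmmx_M2 : bmmx M2.
Proof.
apply: bmmxB; first by apply: bmmxD => //; exact: bmmx_tr.
by apply: bmmxM => //; exact: bmmx_tr.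
Qed.

Lemma Ex_lap_le v :
  Ex P (fun w => qf (M1 w) v) <= amax / alpha * Ex P (fun w => qf (M2 w) v).
Proof.
under eq_fun do rewrite qf_trmul_ones.
under [in leRHS]eq_fun do rewrite qf_sym_lap.
rewrite -/(g v) (le_trans (Ex_sqr_sum_lap_le v))//.
have bgg i : bmfun (fun w => g v i w ^+ 2) by exact: bmfunX.
rewrite ExB; last 2 first.
- by apply: bmfunZ; apply: bmfun_sum => i _; exact/bmfunZ/(bg v i).
- by apply: bmfun_sum => i _; exact: bgg.
rewrite Ex_lap_form Ex_sum; last by move=> i _; exact: bgg.
rewrite -sumrB mulr_sumr; apply: ler_sum => i _.
rewrite -(ExB _ _ _ (bS v i) (bgg i)) -ExZ; last exact: bmfunB.
apply: le_Ex => //; first by apply: bmfunZ; exact: bmfunB.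
by apply: filterS (lap_row_bound v) => w; exact.
Qed.

Lemma leqmx_Emx_lap : leqmx (Emx P M1) ((amax / alpha) *: Emx P M2).
Proof.
have E (X Y : 'M[R]_1) c :
  (X - c *: Y) ord0 ord0 = X ord0 ord0 - c * Y ord0 ord0 by rewrite !mxE.
move=> v; rewrite mulmxBr mulmxBl -scalemxAr -scalemxAl E subr_le0.
rewrite -/(qf _ v) -/(qf (Emx P M2) v).
rewrite (qf_Emx P M1 v bmmx_M1) (qf_Emx P M2 v bmmx_M2).
exact: Ex_lap_le.
Qed.

(** A step changes the form by [qf (M1 w) v - amax / alpha * qf (M2 w) v], of nonpositive mean by
    [Ex_lap_le], and by a multiple of the sum of the [g v i w], of mean zero. *)
Lemma Ex_lyapunov_step (v : 'cV[R]_N) :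
  Ex P (fun w => qf (lyapunov (amax / alpha)) (v - lap (M w) *m v)) <=
  qf (lyapunov (amax / alpha)) v.
Proof.
set K := lyapunov (amax / alpha); pose s := \sum_i v i ord0.
have E w : qf K (v - lap (M w) *m v) = qf K v
    + (qf (M1 w) v - amax / alpha * qf (M2 w) v) - 2 * s * \sum_i g v i w.
  rewrite /K !qf_lyapunov qf_trmul_ones qf_sym_lap -/(g v).
  have zE i : (v - lap (M w) *m v) i ord0 = v i ord0 - (lap (M w) *m v) i ord0.
    by rewrite 2!mxE.
  rewrite (eq_bigr _ (fun i _ => zE i)) sumrB -/s.
  have -> : \sum_i (v - lap (M w) *m v) i ord0 ^+ 2 =
      \sum_i v i ord0 ^+ 2 - 2 * (\sum_i v i ord0 * (lap (M w) *m v) i ord0)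
      + \sum_i (lap (M w) *m v) i ord0 ^+ 2.
    rewrite mulr_sumr -sumrB -big_split.
    by apply: eq_bigr => i _ /=; rewrite zE; ring.
  rewrite /g; ring.
under eq_fun do rewrite E.
have b1 : bmfun (fun w => qf (M1 w) v).
  by apply: bmfun_qf; [exact: bmmx_M1|exact: bmmx_cst].
have b2 : bmfun (fun w => amax / alpha * qf (M2 w) v).
  by apply: bmfunZ; apply: bmfun_qf; [exact: bmmx_M2|exact: bmmx_cst].
rewrite ExB; last 2 first.
- by apply: bmfunD; [exact: bmfun_cst|exact: bmfunB].
- by apply: bmfunZ; exact: bmfun_sum.
rewrite ExD ?Ex_cst; [|exact: bmfun_cst|exact: bmfunB].
rewrite (ExB _ _ _ b1 b2) (ExZ _ (2 * s)); last exact: bmfun_sum.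
rewrite Ex_sum// Ex_sum_lap mulr0 subr0 gerDl subr_le0 ExZ ?Ex_lap_le//.
by apply: bmfun_qf; [exact: bmmx_M2|exact: bmmx_cst].
Qed.

End one_step.

(** * Mean and variance in terms of the quadratic form *)

Section mean_and_variance.
Context {R : realType} {N : nat}.
Hypothesis N_gt0 : (0 < N)%N.
Implicit Type x : 'cV[R]_N.

Let N_neq0 : N%:R != 0 :> R. Proof. by rewrite pnatr_eq0 -lt0n. Qed.

Lemma sum_centered x (c : R) :
  \sum_i (x - const_mx c) i ord0 = N%:R * (mean x - c).
Proof.
under eq_bigr do rewrite !mxE.
rewrite sumrB sumr_const card_ord -[c *+ N]mulr_natl mulrBr /mean.
by rewrite [X in _ = X - _]mulrC divfK.
Qed.

(** Centring at the mean kills the squared sum, leaving the norm term. *)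
Lemma qf_lyapunov_centered (g : R) x :
  qf (lyapunov g) (x - const_mx (mean x)) = g * (N%:R * var x).
Proof.
rewrite qf_lyapunov sum_centered subrr mulr0 expr0n add0r /var.
by rewrite [N%:R * _]mulrC divfK//; congr (_ * _);
  apply: eq_bigr => i _; rewrite !mxE.
Qed.

Lemma le_qf_lyapunov (g c : R) x : 0 <= g ->
  (N%:R * (N%:R + g)) * (mean x - c) ^+ 2 <=
  qf (lyapunov g) (x - const_mx c).
Proof.
move=> g0; rewrite qf_lyapunov sum_centered.
set z := x - _; set D := mean x - c.
(* [D] is the mean of [z], so expanding gives that the sum of the squares of [z] is at least
   [N%:R * D ^+ 2]. *)
have : 0 <= \sum_i (z i ord0 - D) ^+ 2.
  by apply: sumr_ge0 => i _; exact: sqr_ge0.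
have -> : \sum_i (z i ord0 - D) ^+ 2 =
    \sum_i z i ord0 ^+ 2 - 2 * D * (\sum_i z i ord0) + N%:R * D ^+ 2.
  have -> : N%:R * D ^+ 2 = \sum_(i < N) D ^+ 2.
    by rewrite sumr_const card_ord mulr_natl.
  by rewrite mulr_sumr -sumrB -big_split; apply: eq_bigr => i _ /=; ring.
rewrite sum_centered -/D; move: (\sum_i _) => S h.
have : g * (N%:R * D ^+ 2) <= g * S by rewrite ler_wpM2l//; nra.
by nra.
Qed.

End mean_and_variance.

(** * Monotonicity in mean along the random trajectory *)

Section dynamics.
Context {d : measure_display} {T : measurableType d} {R : realType}.
Context {N : nat}.
Variables (P : probability T R) (A : nat -> T -> 'M[R]_N).
Variables (x0 : 'cV[R]_N) (K : 'M[R]_N) (c : R).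
Hypothesis mA : rmx_measurable A.
Hypothesis indepA : indep_mx_seq P A.
Hypothesis A_bounded : exists C : R, forall t w i j, `|A t w i j| <= C.
Hypothesis step_le : forall t v,
  Ex P (fun w => qf K (v - lap (A t w) *m v)) <= qf K v.

Let z t w := traj A x0 t w - const_mx c.

Let zS t w : z t.+1 w = (1%:M - lap (A t w)) *m z t w.
Proof.
by rewrite /z /= mulmxBl mul1mx mulmxBr lap_mul_const subr0 addrAC.
Qed.

Let bA s t : t \in s ->
  bmmx (A t : g_sigma_algebraType (cylinders A s) -> 'M[R]_N).
Proof.
move=> ts i j; split; first exact: measurable_entry_cylinders.
by have [C AC] := A_bounded; exists C.
Qed.

(** [iota 0 t] lists the times 0 to t - 1: [z t] depends on these matrices and not on [A t]. *)
Let bz t :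
  bmmx (z t : g_sigma_algebraType (cylinders A (iota 0 t)) -> 'cV[R]_N).
Proof.
apply: bmmxB; last exact: bmmx_cst.
move=> i j; rewrite [j]ord1.
apply: (@bmfun_traj _ (g_sigma_algebraType (cylinders A (iota 0 t)))).
by move=> s k l st; apply: bA; rewrite mem_iota.
Qed.

(** The new value is the form of [M] at [z t], where [M] depends on [A t] alone and [z t] on the
    past, so [Ex_qf] averages [M] first. *)
Lemma Ex_qf_traj_step t :
  Ex P (fun w => qf K (z t.+1 w)) <= Ex P (fun w => qf K (z t w)).
Proof.
pose M w := (1%:M - lap (A t w))^T *m K *m (1%:M - lap (A t w)).
have bM : bmmx (M : g_sigma_algebraType (cylinders A [:: t]) -> 'M[R]_N).
  have b1 : bmmx (fun w : g_sigma_algebraType (cylinders A [:: t]) =>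
      1%:M - lap (A t w)).
    apply: bmmxB; first exact: bmmx_cst.
    by apply: bmfun_lap; apply: bA; rewrite mem_head.
  by apply: bmmxM => //; apply: bmmxM; [exact: bmmx_tr|exact: bmmx_cst].
have bM' : bmmx M by move=> i j; exact: (bmfun_cylinders _ mA _ _ (bM i j)).
have bz' : bmmx (z t).
  by move=> i j; exact: (bmfun_cylinders _ mA _ _ (bz t i j)).
under eq_fun do rewrite zS -qf_congr.
rewrite (Ex_qf P M (z t)) => //; last first.
  move=> i j; apply: (ExM_cylinders _ _ mA indepA (iota 0 t) [:: t]).
  - by rewrite cat_uniq iota_uniq/= mem_iota add0n ltnn.
  - by apply: bmfunM; exact: bz.
  - exact: bM.
apply: le_Ex.
- by apply: bmfun_qf => //; exact: bmmx_cst.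
- by apply: bmfun_qf => //; exact: bmmx_cst.
(* With [M] averaged, [z t w] is a fixed vector for each [w], and [step_le] applies to it. *)
apply: aeW => w; rewrite qf_Emx//; apply: le_trans (step_le t (z t w)).
by under eq_fun do rewrite qf_congr mulmxBl mul1mx.
Qed.

Lemma Ex_qf_traj t :
  Ex P (fun w => qf K (z t w)) <= qf K (x0 - const_mx c).
Proof.
elim: t => [|t IHt]; first by rewrite /z /= Ex_cst.
exact: le_trans (Ex_qf_traj_step t) IHt.
Qed.

Lemma bmmx_traj t : bmmx (traj A x0 t).
Proof.
move=> i j; rewrite [j]ord1; apply: bmfun_traj => s k l _.
split; first exact: mA.
by have [C AC] := A_bounded; exists C.
Qed.

End dynamics.

Theorem theorem4 (d : measure_display) (T : measurableType d) (R : realType)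
  (P : probability T R) (N : nat) (hN : (0 < N)%N)
  (A : nat -> T -> 'M[R]_N) (x0 : 'cV[R]_N) (amax alpha : R) :
  rmx_measurable A ->
  indep_mx_seq P A ->
  ident_distr_mx P A ->
  (forall t w (i j : 'I_N), 0 <= A t w i j) ->
  (forall t w (i : 'I_N), \sum_j A t w i j = 1) ->
  (forall t, (ones N)^T *m Emx P (fun w => lap (A t w)) = 0) ->
  0 < amax -> 0 < alpha ->
  (forall t, {ae P, forall w, forall i : 'I_N,
      \sum_(j | j != i) A t w i j <= amax /\ alpha <= A t w i i}) ->
  (forall t (i j k l : 'I_N), i != k ->
      ('E_P[fun w => (A t w i j * A t w k l)%R] =
       'E_P[fun w => A t w i j] * 'E_P[fun w => A t w k l])%E) ->
  let gamma := amax / alpha in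
  (forall t, leqmx
     (Emx P (fun w => (lap (A t w))^T *m ones N *m (ones N)^T *m lap (A t w)))
     (gamma *: Emx P (fun w => lap (A t w) + (lap (A t w))^T
                                - (lap (A t w))^T *m lap (A t w))))
  /\
  (forall t, ('E_P[fun w => ((mean (traj A x0 t w) - mean x0) ^+ 2)%R]
              <= ((gamma / (N%:R + gamma) * var x0)%R)%:E)%E).
Proof.
move=> mA indepA _ A0 A1 Amean amax0 alpha0 Abnd Auncorr gamma.
have gamma0 : 0 < gamma by exact: divr_gt0.
have A_le1 t w i j : `|A t w i j| <= 1.
  by rewrite ger0_norm// -(A1 t w i) (bigD1 j)//= lerDl sumr_ge0.
have A_bounded : exists C : R, forall t w i j, `|A t w i j| <= C by exists 1.
have bA t : bmmx (A t).
  by move=> i j; split; [exact: mA|exists 1].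
have uncorr t i j k l : i != k -> Ex P (fun w => A t w i j * A t w k l) =
    Ex P (fun w => A t w i j) * Ex P (fun w => A t w k l).
  move=> ik; apply: EFin_inj; rewrite EFinM !EFin_Ex ?Auncorr//; try exact: bA.
  by apply: bmfunM; exact: bA.
split=> t.
  exact: (leqmx_Emx_lap _ _ _ _ (bA t) (A0 t) (A1 t) (Amean t) alpha0 (Abnd t)
    (uncorr t)).
have K_le s v : Ex P (fun w =>
    qf (lyapunov gamma) (v - lap (A s w) *m v)) <= qf (lyapunov gamma) v.
  exact: (Ex_lyapunov_step _ _ _ _ (bA s) (A0 s) (A1 s) (Amean s) alpha0
    (Abnd s) (uncorr s)).
have bx := bmmx_traj A x0 mA A_bounded t.
have bD : bmfun (fun w => (mean (traj A x0 t w) - mean x0) ^+ 2).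
  apply: bmfunX; apply: bmfunB; last exact: bmfun_cst.
  by apply: bmfunM; [apply: bmfun_sum => i _; exact: bx|exact: bmfun_cst].
rewrite -EFin_Ex// lee_fin.
have N0 : 0 < N%:R :> R by rewrite ltr0n.
have NNg : 0 < N%:R * (N%:R + gamma) by rewrite mulr_gt0// addr_gt0.
(* Scaling by [N%:R * (N%:R + gamma)] turns the left side into the lower bound of [le_qf_lyapunov]
   and the right side into the form at the centred [x0]. *)
rewrite -(ler_pM2l NNg) -ExZ//.
have -> : N%:R * (N%:R + gamma) * (gamma / (N%:R + gamma) * var x0) =
    gamma * (N%:R * var x0).
  by field; rewrite gt_eqF// addr_gt0.
rewrite -qf_lyapunov_centered//.
apply: le_trans (Ex_qf_traj P A x0 _ _ mA indepA A_bounded K_le t).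
apply: le_Ex; first exact: bmfunZ.
  apply: bmfun_qf; first exact: bmmx_cst.
  by apply: bmmxB => //; exact: bmmx_cst.
by apply: aeW => w; apply: le_qf_lyapunov => //; exact: ltW.
Qed.
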